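(* Let $f:[0,+\infty)\to\mathbb R$ be of bounded variation. Then the Euler constant of $f$, defined by $$\gamma^f:=\lim_{n\to+\infty}\gamma^f_n,$$ exists and is finite, and for every $n\in\mathbb N$ the following estimate of $\gamma^f$ holds: $$\gamma^f=\gamma^f_n-\frac12\big(f(\infty)-f(n)\big)+\varepsilon_1(n),\qquad |\varepsilon_1(n)|\le\frac12\,\mathrm{pV}(f,[n,+\infty)),$$ that is, the real number $\varepsilon_1(n)$ defined by the equality satisfies the inequality.
   Context: For a real-valued function $f$ on an interval $I$, the pointwise variation of $f$ on $I$ is $$\mathrm{pV}(f,I):=\sup\Big\{\sum_{0\le i<m}|f(t_{i+1})-f(t_i)|:\ t_i\in I,\ t_0<t_1<\dots<t_m\Big\},$$ and $f$ is of bounded variation on $I$ if $\mathrm{pV}(f,I)<+\infty$. $\mathbb N=\{0,1,2,\dots\}$. For $f:[0,+\infty)\to\mathbb R$ locally integrable and $n\in\mathbb N$, $$\gamma^f_n:=\sum_{0\le k<n}f(k)-\int_0^n f(x)\,dx,$$ where $\sum_{0\le k<n}f(k)=\sum_{k=0}^{n-1}f(k)$ (empty sum equal to $0$). If $f$ is of bounded variation on $[0,+\infty)$, it is locally integrable and $f(\infty):=\lim_{x\to+\infty}f(x)$ exists and is finite. *)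

(* Defs.v *)
From HB Require Import structures.
From mathcomp Require Import all_boot all_order all_algebra.
From mathcomp Require Import all_classical all_reals all_analysis.

Set Implicit Arguments.
Unset Strict Implicit.
Unset Printing Implicit Defensive.

Import Order.TTheory GRing.Theory Num.Theory.
Import numFieldNormedType.Exports.

Local Open Scope classical_set_scope.
Local Open Scope ring_scope.

(* A real function on an interval is represented by a total function R -> R
   whose values outside the interval are irrelevant.
   The library's [total_variation] only covers compact intervals [a, b]; the
   supremum below is taken over finite sequences t_0 < ... < t_m in any
   interval (only t 0, ..., t m matter, and m = 0 contributes the empty sum). *)
Definition pV (R : realType) (f : R -> R) (I : interval R) : \bar R :=
  ereal_sup [set s | exists (m : nat) (t : nat -> R),
    [/\ forall i, (i <= m)%N -> t i \in I,
        forall i, (i < m)%N -> t i < t i.+1 &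
        s = (\sum_(0 <= i < m) `|f (t i.+1) - f (t i)|)%:E]].

Definition of_bounded_variation (R : realType) (f : R -> R)
    (I : interval R) : Prop :=
  (pV f I < +oo)%E.

Definition euler_partial (R : realType) (f : R -> R) (n : nat) : R :=
  \sum_(0 <= k < n) f k%:R -
  \int[@lebesgue_measure R]_(x in `[0, n%:R]) f x.

(* Meaningful only when the sequence converges, since [lim] is total. *)
Definition euler_constant (R : realType) (f : R -> R) : R :=
  limn (euler_partial f).

(* Meaningful only when f converges at +oo, which holds when f is of bounded
   variation on [0, +oo[. *)
Definition value_at_infty (R : realType) (f : R -> R) : R :=
  lim (f x @[x --> +oo]).

(* Main.v *)
Require Import Defs.
From HB Require Import structures.
From mathcomp Require Import all_boot all_order all_algebra.
From mathcomp Require Import all_classical all_reals all_analysis.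
From mathcomp Require Import measurable_realfun lra ring.

Import Order.TTheory GRing.Theory Num.Theory.
Import numFieldNormedType.Exports.

Local Open Scope classical_set_scope.
Local Open Scope ring_scope.

(* Let [v x] be the variation of [f] on [[0, x]]. On a unit interval the
   trapezoidal rule for [f] has error at most half the variation there, so
   [a n = euler_partial f n + f n / 2] satisfies
   [|a m - a n| <= (v m - v n) / 2]. As [v] is nondecreasing and bounded, [f]
   and [a] converge, and the error term [eps1] for [n] is [lim a - a n]. *)

(** A Cauchy pair for [v] pulls back to the domain and its image under [u] is a Cauchy pair for [u].
    The filter is general so as to serve both [x] tending to [+oo] for [f] and [n] tending to [\oo]
    for the corrected sums. *)
Lemma cvg_le_oscillation {R : realType} {T : Type} {F : set_system T}
    {FF : ProperFilter F} (u v : T -> R) :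
  (forall x y, `|u x - u y| <= `|v x - v y|) ->
  cvg (v @ F) -> cvg (u @ F).
Proof.
move=> uv /cvg_cauchy /cauchy_ballP vF.
apply/cauchy_cvgP/cauchy_ballP => e e0.
have [[A B] /= [FA FB] AB] := vF e e0.
exists (u @` (v @^-1` A), u @` (v @^-1` B)) => /=.
  by split; [apply: (@filterS _ F _ (v @^-1` A))|
             apply: (@filterS _ F _ (v @^-1` B))] => // x Ax /=; exists x.
move=> [_ _] /= [[x Ax <-] [y By <-]].
exact: le_lt_trans (uv x y) (AB (v x, v y) (conj Ax By)).
Qed.

Lemma total_variation_le_pV {R : realType} (f : R -> R) {c a b : R} :
  c <= a -> (total_variation a b f <= pV f `[c, +oo[)%E.
Proof.
move=> ca; apply: ge_ereal_sup => _ [_ [s abs <-] <-].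
apply: ereal_sup_ubound; exists (size s), (nth b (a :: s)); split => //.
- move=> i im; rewrite in_itv/= andbT.
  exact/(le_trans ca)/(itv_partition_nth_ge _ abs).
- move=> i im; have [sa _] := abs.
  have st : sorted <%R (a :: s) by [].
  by rewrite (lt_sorted_ltn_nth b st) ?inE ?ltnS//= ltnW.
Qed.

(** A real-valued stand-in for the variation function: it keeps integrals and limits away from
    extended reals and from the endpoint 0. *)
Definition oscillation_le {R : realType} (f v : R -> R) :=
  forall x y, x <= y -> `|f y - f x| <= v y - v x.

Lemma nondecreasing_oscillation {R : realType} {f v : R -> R}
    (fv : oscillation_le f v) : nondecreasing_fun v.
Proof. by move=> x y xy; rewrite -subr_ge0; exact: le_trans (fv x y xy). Qed.

(** Jordan decomposition: [f] is the difference of the monotone functions [f \+ v] and [v], whence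
    its measurability. *)
Lemma nondecreasing_oscillationD {R : realType} {f v : R -> R}
    (fv : oscillation_le f v) : nondecreasing_fun (f \+ v).
Proof. by move=> x y xy /=; have := fv x y xy; rewrite ler_norml; lra. Qed.

Lemma measurable_oscillation {R : realType} {f v : R -> R}
    (fv : oscillation_le f v) (D : set R) : measurable D -> measurable_fun D f.
Proof.
move=> mD; have -> : f = (f \+ v) \- v by apply/funext => x /=; ring.
by apply: measurable_funB; apply: nondecreasing_measurable => //;
  [exact: nondecreasing_oscillationD fv|exact: nondecreasing_oscillation fv].
Qed.

Lemma integrable_oscillation {R : realType} {f v : R -> R}
    (fv : oscillation_le f v) (a b : R) :
  (@lebesgue_measure R).-integrable `[a, b] (EFin \o f).
Proof.
apply: measurable_bounded_integrable => //.
- by rewrite /= lebesgue_measure_itv/=; case: ifP => // _; rewrite -EFinB ltry.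
- exact: measurable_oscillation fv _ _.
- exists (`|f a| + (v b - v a)); split; first exact: num_real.
  move=> M ltM x /=; rewrite in_itv/= => /andP[ax xb].
  have := fv _ _ ax; have := nondecreasing_oscillation fv _ _ xb.
  have := ler_normD (f x - f a) (f a).
  by rewrite subrK; lra.
Qed.

(* The integrand [(f a + f (a + 1)) / 2 - f x] is at most half the variation,
   by the triangle inequality through [x]. *)
Lemma trapezoid {R : realType} {f v : R -> R}
    (fv : oscillation_le f v) (a : R) :
  `|(f a + f (a + 1)) / 2 - \int[@lebesgue_measure R]_(x in `[a, a + 1]) f x|
    <= (v (a + 1) - v a) / 2.
Proof.
have len : fine (lebesgue_measure `[a, a + 1]) = 1.
  by rewrite lebesgue_measure_itv/= lte_fin ltrDl ltr01 -EFinB/= addrC addKr.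
have intc (c : R) : (@lebesgue_measure R).-integrable `[a, a + 1] (EFin \o cst c).
  by apply: (integrable_oscillation (v := cst 0)) => x y _ /=;
    rewrite !subrr normr0.
have cstE (c : R) : \int[@lebesgue_measure R]_(x in `[a, a + 1]) c = c.
  by rewrite Rintegral_cst// len mulr1.
set c := (f a + f (a + 1)) / 2; set w := (v (a + 1) - v a) / 2.
have bnd x : `[a, a + 1]%classic x -> c - w <= f x <= c + w.
  rewrite /= in_itv/= => /andP[ax xa].
  have := fv _ _ ax; have := fv _ _ xa; rewrite !ler_norml /c /w; lra.
(* The interval has length 1, so each constant bound is its own integral and monotonicity of the
   integral applies. *)
rewrite distrC ler_distl -(cstE (c - w)) -(cstE (c + w)).
by apply/andP; split; apply: le_Rintegral => //;
  do ?[exact: intc|exact: integrable_oscillation fv _ _] => x /bnd /andP[].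
Qed.

Lemma euler_partialS {R : realType} {f v : R -> R}
    (fv : oscillation_le f v) (n : nat) :
  euler_partial f n.+1 - euler_partial f n =
  f n%:R - \int[@lebesgue_measure R]_(x in `[n%:R, n%:R + 1]) f x.
Proof.
rewrite /euler_partial big_nat_recr//= -natr1.
(* Subtracting the integral over [[0, n]] from that over [[0, n + 1]] leaves the half-open []n, n +
   1]], so the endpoint [n] is dropped first. *)
rewrite -(Rintegral_itv_obnd_cbnd (r := n%:R)); last first.
  apply: integrableS (integrable_oscillation fv n%:R (n%:R + 1)) => //.
  by apply: subset_itv_oc_cc.
rewrite -(@Rintegral_itvB _ f (BLeft 0) (BRight (n%:R + 1)) n%:R) ?bnd_simp//.
- ring.
- exact: integrable_oscillation fv _ _.
- by rewrite lerDl.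
Qed.

(** Adding [f n / 2] turns each increment of the partial sums into a trapezoidal error on
    [[n, n + 1]]; the bounds in [v] telescope. *)
Lemma trapezoid_sum {R : realType} {f v : R -> R}
    (fv : oscillation_le f v) {n m : nat} : (n <= m)%N ->
  `|(euler_partial f m + f m%:R / 2) - (euler_partial f n + f n%:R / 2)|
    <= (v m%:R - v n%:R) / 2.
Proof.
elim: m => [|m ih]; first by rewrite leqn0 => /eqP ->; rewrite !subrr normr0 mul0r.
rewrite leq_eqVlt => /predU1P[->|/ih {}ih]; first by rewrite !subrr normr0 mul0r.
have := trapezoid fv m%:R; have := euler_partialS fv m; rewrite natr1.
move: ih; rewrite !ler_norml; lra.
Qed.

Lemma cvg_oscillation {R : realType} {f v : R -> R} :
  oscillation_le f v -> cvg (v x @[x --> +oo]) -> cvg (f x @[x --> +oo]).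
Proof.
move=> fv; apply: cvg_le_oscillation => x y.
wlog xy : x y / x <= y => [H|].
  by have [/H//|/ltW/H] := leP x y; rewrite distrC [leRHS]distrC.
by rewrite distrC [leRHS]distrC (le_trans (fv _ _ xy))// ler_norm.
Qed.

Lemma euler_constant_estimate {R : realType} {f v : R -> R} :
  oscillation_le f v -> has_ubound (range v) ->
  cvgn (euler_partial f) /\
  forall n (B : R), (forall m, (n <= m)%N -> v m%:R - v n%:R <= B) ->
  `|euler_constant f - (euler_partial f n -
      2^-1 * (value_at_infty f - f n%:R))| <= 2^-1 * B.
Proof.
move=> fv ubv; have vnd := nondecreasing_oscillation fv.
have cv : cvg (v x @[x --> +oo]) := cvgP _ (nondecreasing_cvgr vnd ubv).
have cf := cvg_oscillation fv cv.
have cn (g : R -> R) : cvg (g x @[x --> +oo]) ->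
    g n%:R @[n --> \oo] --> lim (g x @[x --> +oo]).
  by move=> cg; apply: cvg_comp cg; exact: cvgr_idn.
set a := fun n => euler_partial f n + f n%:R / 2.
have ca : cvgn a.
  apply: (cvg_le_oscillation a (fun n => v n%:R) _ (cvgP _ (cn _ cv))).
  move=> n m; wlog nm : n m / (n <= m)%N => [H|].
    by have [/H//|/ltnW/H] := leqP n m; rewrite distrC [leRHS]distrC.
  rewrite distrC [leRHS]distrC (le_trans (trapezoid_sum fv nm))//.
  (* Convergence only requires domination by [v], so the factor 1/2 is given up here. *)
  have vv : 0 <= v m%:R - v n%:R by rewrite subr_ge0 vnd// ler_nat.
  by rewrite ger0_norm//; lra.
have eE : euler_partial f = (fun n => a n - f n%:R / 2).
  by apply/funext => n; rewrite /a addrK.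
have ce : euler_partial f n @[n --> \oo] -->
    limn a - value_at_infty f / 2.
  rewrite {1}eE; apply: cvgB; first exact: ca.
  by apply: cvgMl; exact: cn.
split; first exact: cvgP ce.
move=> n B HB; rewrite /euler_constant (cvg_lim _ ce)//.
rewrite [X in `|X|](_ : _ = limn a - a n); last by rewrite /a; field.
have cd : `|a m - a n| @[m --> \oo] --> `|limn a - a n|.
  by apply: cvg_norm; apply: cvgB; [exact: ca|exact: cvg_cst].
rewrite -(cvg_lim _ cd)//; apply: limr_le; first exact: cvgP cd.
near=> m; have nm : (n <= m)%N by near: m; exact: nbhs_infty_ge.
by rewrite (le_trans (trapezoid_sum fv nm))//; have := HB _ nm; lra.
Unshelve. all: by end_near. Qed.

Theorem theorem2p4 (R : realType) (f : R -> R)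
    (hf : of_bounded_variation f `[0, +oo[) :
  cvgn (euler_partial f) /\
  forall n : nat, exists eps1 : R,
    euler_constant f =
      euler_partial f n - 2^-1 * (value_at_infty f - f n%:R) + eps1 /\
    (`|eps1|%:E <= (2^-1)%:E * pV f `[n%:R, +oo[)%E.
Proof.
(* Freezing [f] to the left of [0] makes the oscillation bound hold on all of
   [R]; neither side of the claim sees the change. *)
pose g x := f (Num.max 0 x).
pose v x := fine (total_variation 0 (Num.max 0 x) f).
have gE x : 0 <= x -> g x = f x by move=> x0; rewrite /g max_r.
have TVfin a b : 0 <= a -> a <= b -> total_variation a b f \is a fin_num.
  move=> a0 ab; rewrite ge0_fin_numE ?total_variation_ge0//.
  exact: le_lt_trans (total_variation_le_pV f a0) hf.
have vB x y : 0 <= x -> x <= y -> v y - v x = fine (total_variation x y f).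
  move=> x0 xy; rewrite /v !max_r//; last exact: le_trans xy.
  by rewrite (total_variationD f x0 xy) fineD ?TVfin// addrC addKr.
have gv : oscillation_le g v.
  move=> x y xy; rewrite /g.
  (* Both [g] and [v] factor through the nondecreasing map [Num.max 0], so it suffices to compare at
     nonnegative points, where [vB] applies. *)
  have vmax z : v z = v (Num.max 0 z) by rewrite /v maxA maxxx.
  have m0 : 0 <= Num.max 0 x by rewrite le_max lexx.
  have mxy : Num.max 0 x <= Num.max 0 y by rewrite le_max2.
  rewrite (vmax x) (vmax y) vB// -lee_fin fineK ?TVfin//.
  exact: total_variation_ge.
have vub : has_ubound (range v).
  exists (fine (pV f `[0, +oo[)) => _ [x _ <-].
  have m0 : 0 <= Num.max 0 x by rewrite le_max lexx.
  have TVle := @total_variation_le_pV R f 0 0 (Num.max 0 x) (lexx _).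
  apply: fine_le => //; first exact: TVfin.
  rewrite ge0_fin_numE//; exact: le_trans (total_variation_ge0 _ m0) TVle.
have eE : euler_partial g = euler_partial f.
  apply/funext => n; congr (_ - _); first by apply: eq_bigr => k _; rewrite gE.
  by apply: eq_Rintegral => x; rewrite inE/= in_itv/= => /andP[/gE].
have limE : value_at_infty g = value_at_infty f.
  apply/esym/cvg_lim => //.
  have cg := cvg_oscillation gv
    (cvgP _ (nondecreasing_cvgr (nondecreasing_oscillation gv) vub)).
  apply: cvg_trans cg; apply: near_eq_cvg.
  by near=> x; apply: gE; near: x; exact: nbhs_pinfty_ge.
have [cg est] := euler_constant_estimate gv vub.
rewrite /euler_constant eE limE in cg est *; split=> // n.
set c := euler_partial f n - _; exists (limn (euler_partial f) - c).
split; first by rewrite addrC subrK.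
have /(_ n%:R) := @total_variation_le_pV R f n%:R.
(* A real value [B] bounds every [v m - v n], which is the total variation on [[n, m]]; [+oo] makes
   the bound trivial; [-oo] would lie below the total variation on [[n, n]], which is 0. *)
case: (pV _ _) => [B|_|/(_ _ (lexx _))].
- move=> TVB; rewrite -EFinM lee_fin; have := est n B; rewrite gE//; apply=> m nm.
  by rewrite vB ?ler_nat// -lee_fin fineK ?TVfin ?ler_nat// TVB.
- by rewrite gt0_muley ?leey// lte_fin.
- by move=> /(_ n%:R); rewrite total_variationxx.
Unshelve. all: by end_near. Qed.
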